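(* Let $R$ be a commutative ring with identity whose set of zero-divisors $Z_R$ contains a nonzero element, and let $n>1$. Then $\operatorname{diam}O(M_n(R))\ge 3$, and $\operatorname{diam}O(M_n(R))>3$ if and only if there exists $a\in Z_R$ such that the ideal $\operatorname{Ann}(a)$ has no zero-divisors, i.e. $xy\ne 0$ for all nonzero $x,y\in\operatorname{Ann}(a)$.
   Context: The orthogonality graph $O(S)$ of a ring $S$ is the undirected graph whose vertices are the nonzero two-sided zero-divisors of $S$, distinct vertices $x,y$ being adjacent iff $xy=yx=0$; the diameter is the supremum of graph distances between vertices. $Z_R$ is the set of zero-divisors of $R$ (including $0$), $\operatorname{Ann}(a)=\{x\in R: ax=0\}$. *)

(* Defs.v *)
From mathcomp Require Import all_boot all_algebra.
Set Implicit Arguments. Unset Strict Implicit. Unset Printing Implicit Defensive.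
Import GRing.Theory.
Local Open Scope ring_scope.

Definition two_sided_zd (S : pzRingType) (x : S) : Prop :=
  (exists2 y : S, y != 0 & x * y = 0) /\ (exists2 y : S, y != 0 & y * x = 0).

Definition ortho_vertex (S : pzRingType) (x : S) : Prop :=
  x != 0 /\ two_sided_zd x.

Definition ortho_adj (S : pzRingType) (x y : S) : Prop :=
  [/\ ortho_vertex x, ortho_vertex y, x != y, x * y = 0 & y * x = 0].

Fixpoint ortho_path_le (S : pzRingType) (k : nat) (x y : S) : Prop :=
  match k with
  | 0%N => x = y
  | k'.+1 => x = y \/ exists2 z : S, ortho_adj x z & ortho_path_le k' z y
  end.

(* diam O(S) <= k  (diameter = supremum of distances, in N ∪ {oo}). *)
Definition ortho_diam_le (S : pzRingType) (k : nat) : Prop :=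
  forall x y : S, ortho_vertex x -> ortho_vertex y -> ortho_path_le k x y.

(* Zero-divisors of a commutative ring (including 0). *)
Definition zero_divisor (R : comNzRingType) (a : R) : Prop :=
  exists2 b : R, b != 0 & a * b = 0.

Definition Ann (R : comNzRingType) (a : R) : pred R := fun x => a * x == 0.

(* Main.v *)
(** Since [adj A * A = det A], the determinant of a vertex [A] is a zero-divisor.
    Conversely (a two-sided form of McCoy's theorem), if [x <> 0] kills [det A],
    then [A] has a nonzero two-sided annihilator inside [x M_n(R)]: take [k]
    such that [x] kills all [(k+1)]-minors but not all [k]-minors, and let [N] be
    a [(k+1)]-square submatrix having a [k]-minor not killed by [x]; the matrix
    [x adj N], placed at the transposed position, annihilates [A].

    If every [Ann a] has zero-divisors, then for zero-divisors [a], [b] there are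
    nonzero [x] in [Ann a], [y] in [Ann b] with [x y = 0]: if [x x' = 0] in
    [Ann a] and [0 <> y] in [Ann b], use [(x, y)] or [(x', x y)]. Hence
    annihilators of two vertices [A], [B] in [x M_n(R)] and [y M_n(R)] form with
    them a path of length at most 3.

    For the lower bounds, take [A = diag(a,1,...,1)] and its conjugate by
    [1 + E_01]. The annihilators of [A] are the [c E_00] with [c] in [Ann a], those
    of the conjugate the [d (E_00 - E_01)], and the product of the two is
    [c d (E_00 - E_01)]. *)
Require Import Defs.
From mathcomp Require Import all_boot all_algebra.
From Stdlib Require Import Classical.
Set Implicit Arguments. Unset Strict Implicit. Unset Printing Implicit Defensive.
Import GRing.Theory.
Local Open Scope ring_scope.

Lemma matrix_neq0P (R : nmodType) (m n : nat) (A : 'M[R]_(m, n)) :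
  A != 0 -> exists i j, A i j != 0.
Proof.
move=> A0; have [/existsP[i /existsP[j Aij]]|] :=
  boolP [exists i, exists j, A i j != 0]; first by exists i, j.
move=> /existsPn h; case/eqP: A0; apply/matrixP => i j; rewrite mxE.
by have /existsPn/(_ j) := h i; rewrite negbK => /eqP.
Qed.

(** * Orthogonal pairs, paths and conjugation in an arbitrary ring *)

Section Orthogonality.
Variable S : pzRingType.
Implicit Types x y z : S.

Definition orth x y := x * y = 0 /\ y * x = 0.

Lemma orth_vertex x y : x != 0 -> y != 0 -> orth x y -> ortho_vertex x.
Proof. by move=> x0 y0 [xy yx]; split=> //; split; exists y. Qed.

Lemma ortho_adj_orth x y : ortho_adj x y -> y != 0 /\ orth x y.
Proof. by case=> _ [y0 _] _ xy yx. Qed.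

Lemma ortho_path_leS k x y : ortho_path_le k x y -> ortho_path_le k.+1 x y.
Proof.
elim: k x => [x ->|k IHk x]; first by left.
by case=> [->|[z xz zy]]; [left | right; exists z => //; apply: IHk].
Qed.

(** Unlike [ortho_adj], [orth] allows [x = y]; such a step is simply skipped, which the bound on the
    length tolerates. *)
Lemma orth_path_cons k x y z : x != 0 -> y != 0 -> orth x y ->
  ortho_path_le k y z -> ortho_path_le k.+1 x z.
Proof.
move=> x0 y0 oxy yz; have [->|xy] := eqVneq x y; first exact: ortho_path_leS.
right; exists y => //; case: (oxy) => xy0 yx0; split=> //.
  exact: orth_vertex oxy.
by apply: (@orth_vertex y x); last split.
Qed.

Lemma orth_conj u v x y : v * u = 1 -> orth x y ->
  orth (u * x * v) (u * y * v).
Proof.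
move=> vu [xy yx]; split; rewrite -!mulrA (mulrA v u) vu mul1r (mulrA _ _ v).
  by rewrite xy mul0r mulr0.
by rewrite yx mul0r mulr0.
Qed.

Lemma conj_neq0 u v x : v * u = 1 -> x != 0 -> u * x * v != 0.
Proof.
move=> vu; apply: contra_neq => uxv0.
by rewrite -[x]mul1r -vu -[LHS]mulr1 -vu -!mulrA (mulrA u) (mulrA _ v) uxv0
           mul0r mulr0.
Qed.

End Orthogonality.

(** * Two-sided annihilators built from minors *)

Section AnnihilatorFromMinors.
Variables (R : comNzRingType) (n : nat) (x : R).
Implicit Types A : 'M[R]_n.

(* [f] and [g] need not be injective: a minor with a repeated row or column is 0. *)
Definition kills_minors A k :=
  forall f g : 'I_k -> 'I_n, x * \det (mxsub f g A) = 0.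

Lemma kills_minors_tr A k : kills_minors A k -> kills_minors A^T k.
Proof. by move=> h f g; rewrite -trmx_mxsub det_tr. Qed.

(** Selecting [n] rows and columns is multiplication by square matrices on both sides, so each such
    minor is a multiple of [\det A]. *)
Lemma kills_minors_det A : x * \det A = 0 -> kills_minors A n.
Proof.
move=> xA f g; have -> : mxsub f g A = rowsub f 1%:M *m A *m colsub g 1%:M.
  by rewrite mulmx_colsub mulmx1 -rowsubE; apply/matrixP => i j; rewrite !mxE.
by rewrite !det_mulmx mulrAC mulrCA xA mulr0.
Qed.

Lemma kills_minors_threshold A : x != 0 -> x * \det A = 0 ->
  exists k, [/\ (k < n)%N, kills_minors A k.+1 & ~ kills_minors A k].
Proof.
move=> x0 /kills_minors_det hn.
suff: forall m, (m <= n)%N -> kills_minors A m ->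
    exists k, [/\ (k < n)%N, kills_minors A k.+1 & ~ kills_minors A k].
  by move/(_ n (leqnn n) hn).
elim=> [_ h0|m IHm ltmn hm].
  (* The empty minor is 1, so killing it would force [x = 0]. *)
  have id0 : 'I_0 -> 'I_n by case.
  by case/eqP: x0; have := h0 id0 id0; rewrite det_mx00 mulr1.
by have [/IHm|nh] := classic (kills_minors A m); [apply; exact: ltnW | exists m].
Qed.

(** By Laplace expansion along row [t], entry [(i, t)] of the product is the minor in which row
    [f t] is replaced by row [i] of [A]. *)
Lemma scale_colsub_adj A k (f g : 'I_k.+1 -> 'I_n) : kills_minors A k.+1 ->
  x *: (colsub g A *m \adj (mxsub f g A)) = 0.
Proof.
move=> hA; apply/matrixP => i t; rewrite !mxE.
pose f' s := if s == t then i else f s.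
rewrite -[RHS](hA f' g) (expand_det_row _ t); congr (_ * _).
apply: eq_bigr => s _; rewrite !mxE /f' eqxx; congr (_ * (_ * \det _)).
by apply/matrixP => p q; rewrite !mxE eq_sym (negPf (neq_lift _ _)).
Qed.

Lemma scale_adj_rowsub A k (f g : 'I_k.+1 -> 'I_n) : kills_minors A k.+1 ->
  x *: (\adj (mxsub f g A) *m rowsub f A) = 0.
Proof.
move=> /kills_minors_tr hA; apply: trmx_inj.
by rewrite linearZ /= trmx_mul trmx_adj !trmx_mxsub scale_colsub_adj ?trmx0.
Qed.

Lemma exists_notin_codom k (f : 'I_k -> 'I_n) : (k < n)%N ->
  exists i, forall t, f t != i.
Proof.
move=> ltkn; case: (pickP [predC codom f]) => [i /= nfi|full].
  by exists i => t; apply: contraNneq nfi => <-; apply: codom_f.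
have := leq_image_card f 'I_k; rewrite card_ord leqNgt => /negP[].
rewrite (leq_trans ltkn) // -{1}[n]card_ord; apply: subset_leq_card.
by apply/subsetP => i _; exact: negbFE (full i).
Qed.

(** The new index goes first, so that deleting row 0 and column 0 of the enlarged submatrix gives
    back the original one. *)
Definition ord_cons k (i : 'I_n) (f : 'I_k -> 'I_n) (t : 'I_k.+1) : 'I_n :=
  if unlift ord0 t is Some s then f s else i.

Lemma ord_cons_eq k i (f : 'I_k -> 'I_n) t : (forall s, f s != i) ->
  (i == ord_cons i f t) = (t == ord0).
Proof.
move=> fi; rewrite /ord_cons; case: unliftP => [s ->|->]; last by rewrite !eqxx.
by rewrite eq_sym (negPf (fi s)) eq_sym (negPf (neq_lift _ _)).
Qed.

Lemma scaled_annihilator A : x != 0 -> x * \det A = 0 ->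
  exists C : 'M[R]_n, [/\ x *: C != 0, A *m (x *: C) = 0 & (x *: C) *m A = 0].
Proof.
move=> x0 /(kills_minors_threshold x0)[k [ltkn hA nhA]].
have [f /not_all_ex_not[g /eqP xfg]] := not_all_ex_not _ _ nhA.
have [[i fi] [j gj]] := (exists_notin_codom f ltkn, exists_notin_codom g ltkn).
pose f' := ord_cons i f; pose g' := ord_cons j g; pose N := mxsub f' g' A.
pose F : 'M[R]_(_, n) := rowsub f' 1%:M; pose G : 'M[R]_(n, _) := colsub g' 1%:M.
exists (G *m \adj N *m F); split.
(* Since [j] and [i] are new indices, [g'] and [f'] take these values only at 0. Hence entry
   [(j, i)] of the product is entry [(0, 0)] of [\adj N], the [k]-minor that [x] does not kill. *)
- have Gj : row j G = delta_mx 0 ord0.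
    by apply/rowP => t; rewrite !mxE eqxx ord_cons_eq.
  have Fi : col i F = delta_mx ord0 0.
    by apply/colP => t; rewrite !mxE eqxx andbT eq_sym ord_cons_eq.
  have GNF : (G *m \adj N *m F) j i = \det (mxsub f g A).
    transitivity ((row j G *m \adj N *m col i F) 0 0).
      rewrite -row_mul [LHS]mxE [RHS]mxE; apply: eq_bigr => s _.
      by congr (_ * _); rewrite [RHS]mxE.
    rewrite Gj Fi -rowE -colE !mxE /cofactor addn0 expr0 mul1r; congr (\det _).
    by apply/matrixP => p q; rewrite !mxE /f' /g' /ord_cons !liftK.
  apply: contra_neq xfg => /matrixP/(_ j i); rewrite mxE GNF => ->; exact: mxE.
- rewrite -scalemxAr !mulmxA mulmx_colsub mulmx1 scalemxAl.
  by rewrite scale_colsub_adj ?mul0mx.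
- rewrite -scalemxAl -mulmxA -rowsubE -mulmxA scalemxAr.
  by rewrite scale_adj_rowsub ?mulmx0.
Qed.

End AnnihilatorFromMinors.

(** * Zero-divisors of [R] and the upper bound 3 *)

Section ZeroDivisors.
Variable R : comNzRingType.

Lemma det_zero_divisor n (A : 'M[R]_n) :
  ortho_vertex A -> zero_divisor (\det A).
Proof.
case=> _ [[Y /matrix_neq0P[i [j Yij]] AY0] _]; exists (Y i j) => //.
have : \adj A *m (A *m Y) = 0 by rewrite -[A *m Y]/(A * Y) AY0 mulmx0.
by rewrite mulmxA mul_adj_mx mul_scalar_mx => /matrixP/(_ i j); rewrite !mxE.
Qed.

Lemma orthogonal_annihilators (a b : R) :
  (forall c, zero_divisor c -> exists x y : R,
     [/\ c * x = 0, c * y = 0, x != 0, y != 0 & x * y = 0]) ->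
  zero_divisor a -> zero_divisor b ->
  exists x y : R, [/\ x != 0, y != 0, a * x = 0, b * y = 0 & x * y = 0].
Proof.
move=> h /h[x [x' [ax ax' x0 x'0 xx']]] [y y0 b_y].
have [xy|xy] := eqVneq (x * y) 0; first by exists x, y.
exists x', (x * y); split=> //; first by rewrite mulrCA b_y mulr0.
by rewrite mulrA (mulrC x') xx' mul0r.
Qed.

Lemma ortho_diam_le3 n :
  (forall c : R, zero_divisor c -> exists x y : R,
     [/\ c * x = 0, c * y = 0, x != 0, y != 0 & x * y = 0]) ->
  ortho_diam_le 'M[R]_n 3.
Proof.
move=> h A B vA vB.
have [x [y [x0 y0 xA yB xy]]] :=
  orthogonal_annihilators h (det_zero_divisor vA) (det_zero_divisor vB).
rewrite mulrC in xA; rewrite mulrC in yB.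
have [C [C0 AC CA]] := scaled_annihilator x0 xA.
have [D [D0 BD DB]] := scaled_annihilator y0 yB.
have [[A0 _] [B0 _]] := (vA, vB).
apply: (@orth_path_cons _ 2 _ (x *: C)) => //.
apply: (@orth_path_cons _ 1 _ (y *: D)) => //; last first.
  exact: (@orth_path_cons _ 0 _ B).
split; rewrite -[_ * _]/(_ *m _) -scalemxAl -scalemxAr scalerA ?xy ?scale0r //.
by rewrite mulrC xy scale0r.
Qed.

(** * A diagonal matrix and its conjugate at large distance *)

Variables (m : nat) (a b : R).
Hypotheses (b0 : b != 0) (ab : a * b = 0).
Local Notation M := 'M[R]_m.+2.
Local Notation i0 := (ord0 : 'I_m.+2).
Local Notation i1 := (lift ord0 ord0 : 'I_m.+2).

Definition diag_a1 : M := diag_mx (\row_j if j == i0 then a else 1).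
Definition shear : M := 1 + delta_mx i0 i1.
Definition unshear : M := 1 - delta_mx i0 i1.
Definition sheared : M := shear * diag_a1 * unshear.

Lemma unshearK : unshear * shear = 1.
Proof.
rewrite /unshear /shear mulrDr mulr1 mulrBl mul1r.
by rewrite -[_ * delta_mx _ _]/(_ *m _) mul_delta_mx_0 // subr0 subrK.
Qed.

Lemma shearK : shear * unshear = 1.
Proof.
rewrite /unshear /shear mulrBr mulr1 mulrDl mul1r.
by rewrite -[_ * delta_mx _ _]/(_ *m _) mul_delta_mx_0 // addr0 addrK.
Qed.

Lemma shear_conj_delta :
  shear * delta_mx i0 i0 * unshear = delta_mx i0 i0 - delta_mx i0 i1.
Proof.
rewrite /unshear /shear mulrDl mul1r -[delta_mx i0 i1 * _]/(_ *m _).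
rewrite mul_delta_mx_0 // addr0 mulrBr mulr1 -[_ * delta_mx i0 i1]/(_ *m _).
by rewrite mul_delta_mx.
Qed.

Lemma orth_diag_a1 (C : M) :
  orth diag_a1 C -> C = C i0 i0 *: delta_mx i0 i0 /\ a * C i0 i0 = 0.
Proof.
rewrite /orth -[_ * C]/(_ *m _) -[C * _]/(_ *m _) mul_diag_mx mul_mx_diag.
case=> /matrixP AC /matrixP CA; split; last first.
  by have := AC i0 i0; rewrite !mxE eqxx.
apply/matrixP => i j; have := AC i j; have := CA i j; rewrite !mxE.
(* Off index 0 the diagonal entries are 1: [CA] kills the columns [j != i0] of [C], and [AC] the
   rows [i != i0]. *)
have [->|_] := eqVneq j i0; last by rewrite mulr1 andbF mulr0.
by have [->|_] := eqVneq i i0; rewrite ?mulr1 // mul1r mulr0.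
Qed.

Lemma orth_sheared (D : M) : orth sheared D ->
  exists d, a * d = 0 /\ D = d *: (delta_mx i0 i0 - delta_mx i0 i1).
Proof.
(* Conjugating back by [unshear] reduces to the annihilators of [diag_a1]. *)
move=> /(orth_conj shearK); rewrite /sheared -!mulrA unshearK mulr1.
rewrite (mulrA unshear) unshearK mul1r => /orth_diag_a1[eD aD].
exists (((unshear * (D * shear)) : M) i0 i0); split=> //.
rewrite -[LHS]mul1r -shearK -[LHS]mulr1 -shearK -!mulrA (mulrA D) (mulrA unshear).
by rewrite -shear_conj_delta scalerAl scalerAr -eD mulrA.
Qed.

Lemma diag_a1_vertex : ortho_vertex diag_a1.
Proof.
apply: (@orth_vertex _ _ (b *: delta_mx i0 i0)).
- by apply/negP => /eqP/matrixP/(_ i1 i1)/eqP; rewrite !mxE eqxx oner_eq0.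
- by apply: contraNneq b0 => /matrixP/(_ i0 i0)/eqP; rewrite !mxE eqxx mulr1.
rewrite /orth -[diag_a1 * _]/(_ *m _) -[_ * diag_a1]/(_ *m _).
rewrite mul_diag_mx mul_mx_diag.
split; apply/matrixP => i j; rewrite !mxE.
  by case: (i == i0); rewrite ?andbF /= ?mulr0 // mulrA ab mul0r.
by case: (j == i0); rewrite ?andbF /= ?mulr0 ?mul0r // mulrAC (mulrC b) ab mul0r.
Qed.

Lemma sheared_vertex : ortho_vertex sheared.
Proof.
have [A0 [[Y Y0 AY] [Z Z0 ZA]]] := diag_a1_vertex.
split; first exact: (conj_neq0 unshearK).
split; [exists (shear * Y * unshear) | exists (shear * Z * unshear)];
  rewrite ?(conj_neq0 unshearK) // /sheared -!mulrA (mulrA unshear) unshearK mul1r.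
  by rewrite (mulrA _ Y) AY mul0r mulr0.
by rewrite (mulrA Z) ZA mul0r mulr0.
Qed.

Lemma orth_diag_a1_sheared_mul (C D : M) : C != 0 -> D != 0 ->
  orth diag_a1 C -> orth sheared D ->
  (forall x y : R, x \in Ann a -> y \in Ann a -> x != 0 -> y != 0 -> x * y != 0) ->
  C * D != 0.
Proof.
move=> C0 D0 /orth_diag_a1[eC /eqP aC] /orth_sheared[d [/eqP ad eD]] dom.
have c0 : C i0 i0 != 0 by apply: contraNneq C0 => c0; rewrite eC c0 scale0r.
have d0 : d != 0 by apply: contraNneq D0 => d0; rewrite eD d0 scale0r.
apply: contraNneq (dom _ _ aC ad c0 d0).
rewrite eC eD -scalerAl -scalerAr scalerA mulrBr.
rewrite -![delta_mx _ _ * _]/(_ *m _) !mul_delta_mx => /matrixP/(_ i0 i0).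
by rewrite !mxE !eqxx /= subr0 !mulr1 => ->.
Qed.

(** The two forms of annihilator differ at entry [(0, 1)], which is 0 in one and [- d] in the other.
    This excludes a common neighbour. *)
Lemma orth_diag_a1_sheared (C : M) : orth diag_a1 C -> orth sheared C -> C = 0.
Proof.
move=> /orth_diag_a1[eC _] /orth_sheared[d [_ eD]].
have d0 : d = 0.
  have /matrixP/(_ i0 i1) := eD; rewrite eC !mxE eqxx /= !mulr0 sub0r mulrN1.
  by move/eqP; rewrite eq_sym oppr_eq0 => /eqP.
by rewrite eD d0 scale0r.
Qed.

Lemma sheared11 : sheared i1 i1 = 1.
Proof.
rewrite /sheared /shear /unshear mulrBr mulr1 mulrDl mul1r.
rewrite -[delta_mx _ _ * _]/(_ *m _) mul_mx_diag -[_ * delta_mx _ _]/(_ *m _).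
rewrite !mxE big1 => [|k _]; first by rewrite eqxx mul0r addr0 subr0.
by rewrite !mxE; case: (eqVneq k i0) => [->|_]; rewrite ?mulr0 // mul0r addr0 mul0r.
Qed.

Lemma not_orth_diag_a1_sheared : ~ orth diag_a1 sheared.
Proof.
case/orth_diag_a1 => /matrixP/(_ i1 i1)/eqP + _.
by rewrite sheared11 !mxE mulr0 oner_eq0.
Qed.

Lemma diag_a1_neq_sheared : diag_a1 != sheared.
Proof.
(* Equality would make [diag_a1] commute with [shear]; comparing entries [(0, 1)] gives [a = 1],
   against [a * b = 0] with [b != 0]. *)
apply/eqP => eq_AB; have : diag_a1 * shear = shear * diag_a1.
  by rewrite {1}eq_AB /sheared -mulrA unshearK mulr1.
move/matrixP/(_ i0 i1)/eqP.
rewrite -[_ * shear]/(_ *m _) -[shear * _]/(_ *m _) mul_diag_mx mul_mx_diag.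
rewrite !mxE !eqxx /= add0r !mulr1 => /eqP a1.
by case/eqP: b0; rewrite -[RHS]ab a1 mul1r.
Qed.

Lemma sheared_dist_gt2 : ~ ortho_path_le 2 diag_a1 sheared.
Proof.
case=> [/eqP|[C /ortho_adj_orth[C0 AC]]]; first by rewrite (negPf diag_a1_neq_sheared).
case=> [eC|[_ /[swap] -> [_ _ _ CB BC]]].
  by apply: not_orth_diag_a1_sheared; rewrite -eC.
by case/eqP: C0; exact: orth_diag_a1_sheared AC (conj BC CB).
Qed.

Lemma sheared_dist_gt3 :
  (forall x y : R, x \in Ann a -> y \in Ann a -> x != 0 -> y != 0 -> x * y != 0) ->
  ~ ortho_path_le 3 diag_a1 sheared.
Proof.
move=> dom [/eqP|[C AC]]; first by rewrite (negPf diag_a1_neq_sheared).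
have [C0 oAC] := ortho_adj_orth AC.
case=> [eC|[D aCD [eD|[B [_ _ _ DB BD] eB]]]].
- by apply: not_orth_diag_a1_sheared; rewrite -eC.
- by apply: sheared_dist_gt2; right; exists C => //; right; exists D.
(* Only a path through two inner vertices [C], [D] remains, and adjacency would give [C * D = 0]. *)
rewrite eB in DB BD; case: aCD => _ [D0 _] _ CD _.
by case/eqP: (orth_diag_a1_sheared_mul C0 D0 oAC (conj BD DB) dom).
Qed.

End ZeroDivisors.

(* diam O(M_n(R)) >= 3 is "~ diam <= 2"; diam > 3 is "~ diam <= 3". *)
Theorem theorem5 (R : comNzRingType) (n : nat) :
  (exists2 a : R, a != 0 & zero_divisor a) -> (1 < n)%N ->
  ~ ortho_diam_le 'M[R]_n 2 /\
  (~ ortho_diam_le 'M[R]_n 3 <->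
   exists2 a : R, zero_divisor a &
     forall x y : R, x \in Ann a -> y \in Ann a -> x != 0 -> y != 0 -> x * y != 0).
Proof.
case: n => [|[|m]] // [a0 _ [b0 b00 ab0]] _; split; last split.
- by move=> /(_ _ _ (diag_a1_vertex m b00 ab0) (sheared_vertex m b00 ab0));
    apply: (sheared_dist_gt2 b00 ab0).
- move=> diam_gt3; apply: NNPP => no_a; apply: diam_gt3; apply: ortho_diam_le3 => c zc.
  apply: NNPP => no_xy; apply: no_a; exists c => // x y /eqP cx /eqP cy x0 y0.
  by apply/eqP => xy; apply: no_xy; exists x, y.
- case=> a [b b_neq0 ab] dom diam_le3.
  apply: (sheared_dist_gt3 b_neq0 ab dom).
  exact: diam_le3 (diag_a1_vertex m b_neq0 ab) (sheared_vertex m b_neq0 ab).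
Qed.
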